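(* Let $X\subset\mathcal L$, $f\in X$, $n\ge1$, $\alpha\in(0,1)$, and let $Y_i=f\left(\frac{i-1}{n}\right)+\epsilon_i$, $i=1,\dots,n$, where $\epsilon_1,\dots,\epsilon_n$ are independent real random variables with mean zero such that for some $\kappa>0$, $v>0$ and all integers $m\ge2$ one has $\mathbb E|\epsilon_i|^m\le v\,m!\,\kappa^{m-2}/2$ for all $i$. Let $k\in\mathbb N_0$ be such that $f^{(n)}\in X_k^{(n)}$. Then $$\mathbb P\left(k_{2\tau_n(\alpha/2)}(f^{(n)})\le k_{\tau_n(\alpha/2)}(Y^{(n)})\le k\right)\ge 1-\alpha .$$
   Context: $\mathcal L^\infty$ is the space of Lebesgue-measurable essentially bounded functions $[0,1]\to\mathbb R$ (genuine functions, not equivalence classes). With $t^-(\delta)=\max(0,t-\delta)$, $t^+(\delta)=\min(1,t+\delta)$, let $\mathcal L$ be the set of $f\in\mathcal L^\infty$ with $f(t)=\lim_{\epsilon\to0}\inf_{0<\delta<\epsilon}\frac{1}{t^+(\delta)-t^-(\delta)}\int_{t^-(\delta)}^{t^+(\delta)}f(s)\,ds$ for all $t\in[0,1]$ (each a.e.-class in $\mathcal L^\infty$ has exactly one representative in $\mathcal L$). The Kolmogorov distance is $d_K(f,g)=\sup_{x\in[0,1]}\left|\int_0^x (f(s)-g(s))\,ds\right|$. Number of modes: for $g:[0,1]\to\mathbb R$ and a partition $P$: $0=t_0<\dots<t_{N}=1$, let $M(g,P)$ be the number of indices $0<i<N$ with $\max(g(t_{i-1}),g(t_{i+1}))<g(t_i)$,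 and let $M(g)=\sup_P M(g,P)$ over all finite partitions. For $n\ge1$ let $PC_n$ be the set of $g\in\mathcal L$ that are constant on each open interval $\left(\frac{i-1}{n},\frac in\right)$, $i=1,\dots,n$. Let $X^{(n)}_j=\{g\in PC_n: M(g)\le j\}$, and for $g\in PC_n$ let $s_j(g)=\inf_{h\in X_j^{(n)}}d_K(g,h)$, $j\in\mathbb N_0$, and $s_{-1}(g)=\infty$. Let $f^{(n)}\in PC_n$ be the function with value $f\left(\frac{i-1}{n}\right)$ on $\left(\frac{i-1}{n},\frac in\right)$, and $Y^{(n)}\in PC_n$ the (random) function with value $Y_i$ on $\left(\frac{i-1}{n},\frac in\right)$, $i=1,\dots,n$. For $\epsilon>0$ and $g\in PC_n$: $k_\epsilon(g)=\max\{j\in\mathbb N_0: s_{j-1}(g)\ge\epsilon\}$. For $\beta\in(0,1)$ the threshold is $\tau_n(\beta)=\frac1n\left(\sqrt{\log(\beta/2)\left(\log(\beta/2)\kappa^2-2nv\right)}-\kappa\log(\beta/2)\right)$. *)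

(* Defs.v *)
From HB Require Import structures.
From mathcomp Require Import all_boot all_order all_algebra.
From mathcomp Require Import all_classical all_reals all_analysis.
Set Implicit Arguments.
Unset Strict Implicit.
Unset Printing Implicit Defensive.
Import Order.TTheory GRing.Theory Num.Theory.
Import numFieldNormedType.Exports.
Local Open Scope classical_set_scope.
Local Open Scope ring_scope.

(* A function [0,1] -> R is represented by a total function R -> R; every
   notion below depends only on its values on [0,1]. *)

(* The line equipped with the Lebesgue (= Caratheodory) sigma-algebra, which is
   the domain of completed_lebesgue_measure; R itself carries the Borel sets. *)
Definition lebesgueType (R : realType) :=
  caratheodory_type (@wlength R idfun)^*%mu.

Definition Linfty (R : realType) : set (R -> R) :=
  [set f | @measurable_fun _ _ (lebesgueType R) R `[0%R : R, 1%R] f /\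
    exists C : R, {ae @completed_lebesgue_measure R,
      forall t : R, t \in `[0, 1] -> `|f t| <= C}].

(* The mean of f over [t^-(d), t^+(d)]. *)
Definition local_mean (R : realType) (f : R -> R) (t d : R) : R :=
  let tm := Num.max 0 (t - d) in
  let tp := Num.min 1 (t + d) in
  (\int[@completed_lebesgue_measure R]_(s in `[tm, tp]) f s) / (tp - tm).

Definition Lreg (R : realType) : set (R -> R) :=
  [set f | Linfty f /\ forall t : R, t \in `[0, 1] ->
    ereal_inf [set (local_mean f t d)%:E | d in `]0, e[] @[e --> 0^'+]
      --> (f t)%:E].

Definition dK (R : realType) (f g : R -> R) : \bar R :=
  ereal_sup [set `|\int[@completed_lebesgue_measure R]_(s in `[0, x])
                     (f s - g s)|%:E | x in `[0, 1]].

Definition is_partition (R : realType) (N : nat) (t : nat -> R) : Prop :=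
  [/\ t 0 = 0, t N = 1 & forall i : nat, (i < N)%N -> t i < t i.+1].

Definition modes_on (R : realType) (g : R -> R) (N : nat) (t : nat -> R) : nat :=
  #|[pred i : 'I_N | (0 < i)%N &&
      (Num.max (g (t i.-1)) (g (t i.+1)) < g (t i))]|.

Definition modes (R : realType) (g : R -> R) : \bar R :=
  ereal_sup [set x | exists N t, is_partition N t /\
                                 x = (modes_on g N t)%:R%:E].

Definition cell (R : realType) (n i : nat) : set R :=
  `](i%:R / n%:R), (i.+1%:R / n%:R)[.

Definition PC (R : realType) (n : nat) : set (R -> R) :=
  [set g | Lreg g /\
    forall i : 'I_n, exists c : R, forall t, cell n i t -> g t = c].

(* Determines g on all of [0,1], since g t is the limit of its local means. *)
Definition PC_with_values (R : realType) (n : nat) (c : 'I_n -> R)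
    (g : R -> R) : Prop :=
  PC n g /\ forall i : 'I_n, forall t, cell n i t -> g t = c i.

Definition Xmodes (R : realType) (n j : nat) : set (R -> R) :=
  [set g | PC n g /\ (modes g <= j%:R%:E)%E].

Definition smode (R : realType) (n j : nat) (g : R -> R) : \bar R :=
  ereal_inf [set dK g h | h in Xmodes n j].

(* s_{j-1}, with s_{-1} = +oo *)
Definition smode_pred (R : realType) (n j : nat) (g : R -> R) : \bar R :=
  if j is j'.+1 then smode n j' g else +oo%E.

Definition is_max_nat (A : set nat) (m : nat) : Prop :=
  A m /\ forall j, A j -> (j <= m)%N.

(* The maximum exists for every e > 0 and g in PC n: j = 0 qualifies, and g has
   finitely many modes, so s_j(g) = 0 for all large j. *)
Definition kmode (R : realType) (n : nat) (e : R) (g : R -> R) : nat :=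
  xget 0%N (is_max_nat [set j | (e%:E <= smode_pred n j g)%E]).

Definition tau (R : realType) (n : nat) (kappa v beta : R) : R :=
  (Num.sqrt (ln (beta / 2) * (ln (beta / 2) * kappa ^+ 2 - 2 * n%:R * v))
   - kappa * ln (beta / 2)) / n%:R.

Definition mutually_independent (d : measure_display) (T : measurableType d)
    (R : realType) (P : probability T R) (I : finType)
    (X : I -> T -> R) : Prop :=
  forall (J : {set I}) (B : I -> set R), (forall i, measurable (B i)) ->
    P (\big[setI/setT]_(i in J) (X i @^-1` B i)) =
      (\prod_(i in J) P (X i @^-1` B i))%E.

(* Main.v *)
Require Import Defs.
From HB Require Import structures.
From mathcomp Require Import all_boot all_order all_algebra.
From mathcomp Require Import all_classical all_reals all_analysis.
From mathcomp Require Import measurable_realfun.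
From mathcomp Require Import ring lra.
Set Implicit Arguments.
Unset Strict Implicit.
Unset Printing Implicit Defensive.
Import Order.TTheory GRing.Theory Num.Theory.
Import numFieldNormedType.Exports.
Local Open Scope classical_set_scope.
Local Open Scope ring_scope.

(** On [PC_n] the Kolmogorov distance is the maximum over the knots [m / n] of
    the absolute values of the partial means, so [d_K(f^(n), Y^(n))] is
    [1/n] times the maximum of [|eps_1 + ... + eps_m|].  By the maximal form of
    Bernstein's inequality (the moment condition turns the normalised
    exponentials of the partial sums into a nonnegative supermartingale, which
    is stopped at its first passage) this is below [tau_n(alpha/2)] with
    probability at least [1 - alpha/2].  On that event, since [s_j] is 1-Lipschitz for [d_K],
    [s_k(Y) < tau], and [s_(j-1)(f^(n)) >= 2 tau] forces [s_(j-1)(Y) >= tau];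
    both inequalities follow.  The same Lipschitz property yields the
    measurability of the event. *)

(** * Integrals of step functions *)

Lemma integrable_setU d (T : measurableType d) (R : realType)
    (mu : {measure set T -> \bar R}) (A B : set T) (f : T -> R) :
  measurable A -> measurable B -> [disjoint A & B] ->
  mu.-integrable A (EFin \o f) -> mu.-integrable B (EFin \o f) ->
  mu.-integrable (A `|` B) (EFin \o f).
Proof.
move=> mA mB AB /integrableP[mfA fA] /integrableP[mfB fB].
have mf : measurable_fun (A `|` B) (EFin \o f) by apply/measurable_funU.
apply/integrableP; split => //; rewrite ge0_integral_setU//.
- by rewrite lte_add_pinfty.
- exact: measurableT_comp.
Qed.

Section StepIntegral.
Variable R : realType.
Notation mu := (@completed_lebesgue_measure R).

Lemma lebesgueType_measurable_itv (i : interval R) :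
  @measurable _ (lebesgueType R) [set` i].
Proof. by apply: sub_caratheodory; exact: measurable_itv. Qed.

Lemma completed_lebesgue_measure_itv (i : interval R) :
  mu [set` i] = (if (i.1 < i.2)%E then ((i.2 : \bar R) - i.1)%E else 0)%E.
Proof. exact: lebesgue_measure_itv. Qed.

(** The value of [u] at the endpoint [b] is not controlled, but a single point is a null set. *)
Lemma ae_eq_open_itv (a b c : R) (u : R -> R) :
  (forall t, a < t < b -> u t = c) -> ae_eq mu [set` `]a, b]] (EFin \o u) (cst c%:E).
Proof.
move=> uc; exists [set b]; split.
- by rewrite -set_itv1; exact: lebesgueType_measurable_itv.
- exact: lebesgue_measure_set1.
- move=> t /= /not_implyP[]; rewrite in_itv/= => /andP[at_ tb] ut.
  apply/eqP; apply: contrapT => /negP tnb; apply: ut; congr EFin.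
  by apply: uc; rewrite at_ lt_neqAle tnb.
Qed.

Lemma integrable_const_itv (a b c : R) (u : R -> R) :
  (forall t, a < t < b -> u t = c) -> mu.-integrable [set` `]a, b]] (EFin \o u).
Proof.
move=> uc; have mab := lebesgueType_measurable_itv `]a, b].
have aeu := ae_eq_open_itv uc.
have mu_u : @measurable_fun _ _ (lebesgueType R) R [set` `]a, b]] u.
  apply/measurable_EFinP.
  (* Completeness of the measure turns a.e. equality with a constant into measurability. *)
  apply: (ae_measurable_fun completed_lebesgue_measure_is_complete).
    exact: ae_eq_sym aeu.
  exact: measurable_cst.
have fin_ab : (mu [set` `]a, b]] < +oo)%E.
  by rewrite completed_lebesgue_measure_itv; case: ifP => //=; rewrite ltry.
apply/integrableP; split; first exact/measurable_EFinP.
have mau : @measurable_fun _ _ (lebesgueType R) R [set` `]a, b]] (fun t => `|u t|).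
  exact: measurableT_comp.
rewrite (ae_eq_integral (cst `|c|%:E)) /=; last 4 first.
- exact: mab.
- exact/measurable_EFinP.
- exact: measurable_cst.
- by apply: filterS aeu => t h Dt; have /= [->] := h Dt.
by rewrite integral_cst// lte_mul_pinfty.
Qed.

Lemma Rintegral_const_itv (a b c : R) (u : R -> R) : a <= b ->
  (forall t, a < t < b -> u t = c) ->
  \int[mu]_(t in `]a, b]) u t = c * (b - a).
Proof.
move=> ab uc; have mab := lebesgueType_measurable_itv `]a, b].
rewrite /Rintegral (ae_eq_integral (cst c%:E)); last 4 first.
- exact: mab.
- exact: measurable_int (integrable_const_itv uc).
- exact: measurable_cst.
- exact: ae_eq_open_itv.
have muab : mu [set` `]a, b]] = (b - a)%:E.
  rewrite completed_lebesgue_measure_itv/= lte_fin; case: ltP => // ba.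
  by have -> : a = b by [apply/le_anti/andP]; rewrite subrr.
by rewrite integral_cst; [rewrite [X in (_ * X)%E]muab|exact: mab].
Qed.

End StepIntegral.

(** * Primitives of functions constant on the cells *)

Section CellValues.
Variables (R : realType) (n : nat).
Hypothesis n_gt0 : (0 < n)%N.
Notation mu := (@completed_lebesgue_measure R).

(** Sampling at the midpoint stays away from the knots, where [g] takes a limit of local means
    instead of a cell value. Indexing by [nat] lets these values be summed up to any [m]. *)
Definition cell_value (g : R -> R) (i : nat) : R := g ((i%:R + 2^-1) / n%:R).

Lemma cell_mid (i : nat) : cell n i ((i%:R + 2^-1) / n%:R : R).
Proof.
have n0 : (0 : R) < n%:R by rewrite ltr0n.
rewrite /cell/= in_itv/= !ltr_pM2r ?invr_gt0//;
apply/andP; split; first by rewrite ltrDl invr_gt0.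
by rewrite -[i.+1%:R]natr1 ltrD2l; lra.
Qed.

Lemma PC_cell_value (g : R -> R) (i : nat) (t : R) :
  PC n g -> (i < n)%N -> cell n i t -> g t = cell_value g i.
Proof.
move=> [_ gc] lin it; have [c ec] := gc (Ordinal lin).
by rewrite /cell_value !ec//; exact: cell_mid.
Qed.

Lemma PC_with_values_cell_value (c : 'I_n -> R) (g : R -> R) (i : 'I_n) :
  PC_with_values c g -> cell_value g i = c i.
Proof. by case=> _; apply; exact: cell_mid. Qed.

Definition partial_mean (c : nat -> R) (m : nat) : R := (\sum_(i < m) c i) / n%:R.

(** Half-open intervals tile without overlap, so the integral splits at the knot. Since [x] ranges
    over the closed cell, the lemma covers both the step to the next knot and the points in
    between. *)
Lemma partial_mean_step (u : R -> R) (c : nat -> R) (m : nat) (x : R) :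
    (forall i t, (i < n)%N -> cell n i t -> u t = c i) -> (m < n)%N ->
    m%:R / n%:R <= x <= m.+1%:R / n%:R ->
    mu.-integrable [set` `]0, (m%:R / n%:R)]] (EFin \o u) ->
  mu.-integrable [set` `]0, x]] (EFin \o u) /\
  \int[mu]_(t in `]0, x]) u t =
    \int[mu]_(t in `]0, (m%:R / n%:R)]) u t + c m * (x - m%:R / n%:R).
Proof.
move=> uc mn /andP[mx xm] iu.
have m0 : 0 <= m%:R / n%:R :> R by rewrite divr_ge0.
have ucm t : m%:R / n%:R < t < x -> u t = c m.
  move=> /andP[mt tx]; apply: uc => //; rewrite /cell/= in_itv/= mt/=.
  exact: lt_le_trans xm.
have e : (`]0, x] = `]0, m%:R / n%:R] `|` `](m%:R / n%:R), x])%classic.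
  apply/seteqP; split => t /=; rewrite !in_itv/=.
    by move=> /andP[t0 tx]; case: (leP t (m%:R / n%:R)) => h; [left|right];
      rewrite ?t0 ?tx.
  by move=> [] /andP[h1 h2]; apply/andP; split => //; lra.
have dis : [disjoint `]0, m%:R / n%:R]%classic & `](m%:R / n%:R), x]%classic].
  apply/disj_setPLR => t /=; rewrite !in_itv/= => /andP[_ h] /andP[h' _]; lra.
have iU : mu.-integrable (`]0, m%:R / n%:R] `|` `](m%:R / n%:R), x])%classic
    (EFin \o u).
  apply: integrable_setU => //; [exact: lebesgueType_measurable_itv|
    exact: lebesgueType_measurable_itv|exact: integrable_const_itv ucm].
rewrite e; split => //; rewrite Rintegral_setU//.
- by rewrite (Rintegral_const_itv mx ucm).
- exact: lebesgueType_measurable_itv.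
- exact: lebesgueType_measurable_itv.
Qed.

Lemma Rintegral_knot (u : R -> R) (c : nat -> R) (m : nat) :
    (forall i t, (i < n)%N -> cell n i t -> u t = c i) -> (m <= n)%N ->
  mu.-integrable [set` `]0, (m%:R / n%:R)]] (EFin \o u) /\
  \int[mu]_(t in `]0, (m%:R / n%:R)]) u t = partial_mean c m.
Proof.
move=> uc; elim: m => [|m IH] mn.
  rewrite mul0r set_itvoc0; split; first exact: integrable_set0.
  by rewrite Rintegral_set0 /partial_mean big_ord0 mul0r.
have [iu eu] := IH (ltnW mn).
have mm : m%:R / n%:R <= (m.+1%:R / n%:R : R) <= m.+1%:R / n%:R.
  by rewrite lexx andbT ler_pM2r ?invr_gt0 ?ltr0n// ler_nat.
have [iu' ->] := partial_mean_step uc mn mm iu; split => //.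
rewrite eu /partial_mean big_ord_recr/= -natr1.
by field; rewrite pnatr_eq0 -lt0n.
Qed.

(* Between two consecutive knots the integral is a convex combination of its
   values at these knots. *)
Lemma normr_Rintegral_step_le (u : R -> R) (c : nat -> R) (a x : R) :
    (forall i t, (i < n)%N -> cell n i t -> u t = c i) ->
    (forall m, (m <= n)%N -> `|partial_mean c m| <= a) -> 0 <= x <= 1 ->
  `|\int[mu]_(t in `]0, x]) u t| <= a.
Proof.
move=> uc ca /andP[x0 x1].
have n0 : 0 < n%:R :> R by rewrite ltr0n.
(* At [x = 1] the truncation of [n * x] is [n], which indexes no cell; this point is the last
   knot. *)
have [->|xn1] := eqVneq x 1.
  have := (Rintegral_knot uc (leqnn n)).2; rewrite divff ?gt_eqF// => ->.
  exact: ca.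
have nx0 : 0 <= n%:R * x by rewrite mulr_ge0.
have /andP[] := truncn_itv nx0.
set m := Num.truncn _ => mx xm.
have mn : (m < n)%N.
  rewrite -(ltr_nat R); apply: le_lt_trans mx _.
  by rewrite -[ltRHS]mulr1 ltr_pM2l// lt_neqAle xn1.
have mxm : m%:R / n%:R <= x <= m.+1%:R / n%:R.
  by rewrite ler_pdivrMr// ler_pdivlMr// (mulrC x) mx ltW.
have [iu eu] := Rintegral_knot uc (ltnW mn).
have [_ ->] := partial_mean_step uc mn mxm iu; rewrite eu.
(* The position of [x] inside its cell, in units of [1/n]; it is the convex coefficient. *)
pose th := n%:R * x - m%:R.
have -> : partial_mean c m + c m * (x - m%:R / n%:R) =
    (1 - th) * partial_mean c m + th * partial_mean c m.+1.
  rewrite /partial_mean big_ord_recr/= /th; field.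
  by rewrite gt_eqF.
have th0 : 0 <= th by rewrite subr_ge0.
have th1 : 0 <= 1 - th by move: xm; rewrite -natr1 /th; lra.
rewrite (le_trans (ler_normD _ _))// (normrM (1 - th)) (normrM th).
rewrite (ger0_norm th0) (ger0_norm th1).
have -> : a = (1 - th) * a + th * a by ring.
by apply: lerD; (apply: ler_wpM2l; [|apply: ca; rewrite ?(ltnW mn)]).
Qed.

End CellValues.

(** * The Kolmogorov distance on step functions *)

Section KnotNorm.
Variables (R : realType) (n : nat).
Hypothesis n_gt0 : (0 < n)%N.
Notation mu := (@completed_lebesgue_measure R).
Implicit Types (c : nat -> R) (g h : R -> R).

Definition knot_norm c : R := \big[Num.max/0]_(m < n.+1) `|partial_mean n c m|.

Lemma partial_mean_le_knot_norm c m :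
  (m <= n)%N -> `|partial_mean n c m| <= knot_norm c.
Proof.
rewrite -ltnS => mn.
exact: (le_bigmax 0 (fun i : 'I_n.+1 => `|partial_mean n c i|) (Ordinal mn)).
Qed.

Lemma knot_norm_le c a : 0 <= a ->
  (forall m, (m <= n)%N -> `|partial_mean n c m| <= a) -> knot_norm c <= a.
Proof. by move=> a0 ca; apply: bigmax_le => // i _; apply: ca; rewrite -ltnS. Qed.

Lemma knot_norm_lt c a : 0 < a ->
  (forall m, (m <= n)%N -> `|partial_mean n c m| < a) -> knot_norm c < a.
Proof. by move=> a0 ca; apply: bigmax_lt => // i _; apply: ca; rewrite -ltnS. Qed.

Lemma knot_norm_ge0 c : 0 <= knot_norm c.
Proof. exact: bigmax_ge_id. Qed.

Lemma eq_knot_norm c c' :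
  (forall i, (i < n)%N -> c i = c' i) -> knot_norm c = knot_norm c'.
Proof.
move=> cc'; apply: eq_bigr => m _; congr (`|_ / _|); apply: eq_bigr => i _.
by apply: cc'; apply: leq_trans (ltn_ord i) _; rewrite -ltnS.
Qed.

Lemma knot_normD c c' :
  knot_norm (fun i => c i + c' i) <= knot_norm c + knot_norm c'.
Proof.
apply: knot_norm_le => [|m mn]; first by rewrite addr_ge0// knot_norm_ge0.
rewrite /partial_mean big_split/= mulrDl (le_trans (ler_normD _ _))//.
by apply: lerD; exact: partial_mean_le_knot_norm.
Qed.

Lemma knot_normN c : knot_norm (fun i => - c i) = knot_norm c.
Proof.
by apply: eq_bigr => m _; rewrite /partial_mean sumrN mulNr normrN.
Qed.

(** At most [n] summands are divided by [n], so the sup norm dominates [knot_norm]. This is what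
    lets rational vectors approximate real ones. *)
Lemma knot_norm_le_bound c a : 0 <= a ->
  (forall i, (i < n)%N -> `|c i| <= a) -> knot_norm c <= a.
Proof.
move=> a0 ca; apply: knot_norm_le => // m mn.
rewrite /partial_mean normrM (@ger0_norm _ n%:R^-1) ?invr_ge0// ler_pdivrMr ?ltr0n//.
rewrite (le_trans (ler_norm_sum _ _ _))//.
apply: (@le_trans _ _ (\sum_(i < m) a)).
  by apply: ler_sum => i _; apply: ca; exact: leq_trans (ltn_ord i) mn.
by rewrite sumr_const card_ord -[leLHS]mulr_natr ler_wpM2l// ler_nat.
Qed.

(** The primitive of [g - h] is piecewise linear with breaks at the knots, so its absolute value is
    largest at a knot. *)
Lemma dK_PC g h : PC n g -> PC n h ->
  dK g h = (knot_norm (fun i => cell_value n g i - cell_value n h i))%:E.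
Proof.
move=> gP hP; pose u t := g t - h t.
pose c i := cell_value n g i - cell_value n h i; rewrite -/c.
have uc i t : (i < n)%N -> cell n i t -> u t = c i.
  move=> lin it; rewrite /u (PC_cell_value n_gt0 gP lin it).
  by rewrite (PC_cell_value n_gt0 hP lin it).
have n0 : 0 < n%:R :> R by rewrite ltr0n.
have iu x : x <= 1 -> mu.-integrable [set` `]0, x]] (EFin \o u).
  move=> x1; apply: (@integrableS _ _ _ mu [set` `]0, 1]]).
  - exact: lebesgueType_measurable_itv.
  - exact: lebesgueType_measurable_itv.
  - by move=> t /=; rewrite !in_itv/= => /andP[-> /le_trans->].
  - by have := (Rintegral_knot n_gt0 uc (leqnn n)).1; rewrite divff ?gt_eqF.
(* [dK] integrates over closed intervals and the knot lemmas over half-open ones; they differ by the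
   null set [{0}]. *)
have e x : 0 <= x <= 1 -> \int[mu]_(t in `[0, x]) u t = \int[mu]_(t in `]0, x]) u t.
  move=> /andP[x0 x1].
  have m0 : @measurable _ (lebesgueType R) [set 0 : R].
    by rewrite -set_itv1; exact: lebesgueType_measurable_itv.
  have mu0 : mu [set 0] = 0 by exact: lebesgue_measure_set1.
  have mu_0 : measurable_fun ([set 0 : R] : set (lebesgueType R)) (EFin \o u).
    exact: measurable_fun_set1.
  have -> : `[0, x]%classic = [set 0 : R] `|` `]0, x]%classic.
    apply/seteqP; split => t /=; rewrite !in_itv/=.
      move=> /andP[t0 tx]; have [->|tn0] := eqVneq t 0; first by left.
      by right; rewrite tx andbT lt_neqAle eq_sym tn0.
    by move=> [->|/andP[t0 ->]]; rewrite ?lexx ?x0 ?ltW.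
  have dis : [disjoint [set 0 : R] & `]0, x]%classic].
    by apply/disj_setPLR => t /= ->; rewrite in_itv/= ltxx.
  rewrite Rintegral_setU//; last 2 first.
  - exact: lebesgueType_measurable_itv.
  - apply: integrable_setU => //; first exact: lebesgueType_measurable_itv.
    + exact: null_set_integrable.
    + exact: iu.
  by rewrite {1}/Rintegral null_set_integral// add0r.
apply/eqP; rewrite eq_le; apply/andP; split.
  apply: ge_ereal_sup => _ [x xI <-]; rewrite lee_fin.
  move: xI; rewrite /= in_itv/= => xI; rewrite e//.
  apply: (normr_Rintegral_step_le n_gt0 uc) => // m mn.
  exact: partial_mean_le_knot_norm.
have knot m : (m <= n)%N -> (`|partial_mean n c m|%:E <= dK g h)%E.
  move=> mn; apply: ereal_sup_ubound; exists (m%:R / n%:R).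
    by rewrite /= in_itv/= divr_ge0//= ler_pdivrMr// mul1r ler_nat.
  rewrite e; last by rewrite divr_ge0//= ler_pdivrMr// mul1r ler_nat.
  by rewrite (Rintegral_knot n_gt0 uc mn).2.
(* The maximum starts from the default [0], which is bounded by means of the knot [0]. *)
apply: (big_ind (fun a : R => (a%:E <= dK g h)%E)).
- by apply: le_trans (knot 0%N isT); rewrite lee_fin.
- by move=> a b ha hb; rewrite EFin_max ge_max ha.
- by move=> m _; apply: knot; rewrite -ltnS.
Qed.

End KnotNorm.

(** * Distance to the functions with at most [j] modes, and its measurability *)

Section Smode.
Variables (R : realType) (n : nat).
Hypothesis n_gt0 : (0 < n)%N.
Implicit Types (c : nat -> R) (g h : R -> R).

(** This is [smode] expressed through value vectors, so that it can be evaluated at any vector, in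
    particular a rational one, without constructing a step function. *)
Definition knot_dist (j : nat) c : \bar R :=
  ereal_inf [set (knot_norm n (fun i => c i - cell_value n h i))%:E
            | h in @Xmodes R n j].

Lemma smode_knot_dist j g :
  PC n g -> smode n j g = knot_dist j (cell_value n g).
Proof.
move=> gP; congr ereal_inf; apply/seteqP; split => _ [h hX <-]; exists h => //.
  by rewrite (dK_PC n_gt0)//; case: hX.
by rewrite (dK_PC n_gt0)//; case: hX.
Qed.

(** Triangle inequality through a competitor [h], then the infimum over [h]. The additive form in
    the extended reals also covers the value [+oo]. *)
Lemma knot_dist_lipschitz j c c' :
  (knot_dist j c <= knot_dist j c' + (knot_norm n (fun i => c i - c' i))%:E)%E.
Proof.
rewrite -leeBlDr//; apply: le_ereal_inf_tmp => _ [h hX <-].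
rewrite leeBlDr// -EFinD.
apply: ge_ereal_inf; exists (knot_norm n (fun i => c i - cell_value n h i))%:E.
  by exists h.
rewrite lee_fin; apply: le_trans (knot_normD _ _ _).
rewrite le_eqVlt; apply/orP; left; apply/eqP; apply: eq_knot_norm => i _; ring.
Qed.

Lemma knot_dist_ge0 j c : (0 <= knot_dist j c)%E.
Proof. by apply: le_ereal_inf_tmp => _ [h _ <-]; rewrite lee_fin knot_norm_ge0. Qed.

Section Measurability.
Context d (Omega : measurableType d).
Variable Y : nat -> Omega -> R.
Hypothesis mY : forall i, measurable_fun setT (Y i).

Lemma measurable_knot_norm (c : nat -> R) :
  measurable_fun setT (fun w => knot_norm n (fun i => Y i w - c i)).
Proof.
rewrite /knot_norm; elim: (index_enum _) => [|m s IH].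
  by under eq_fun do rewrite big_nil; exact: measurable_cst.
under eq_fun do rewrite big_cons; apply: measurable_maxr => //.
apply: measurableT_comp => //; apply: measurable_funM => //.
by apply: measurable_sum => i; exact: measurable_funB.
Qed.

(* knot_dist is an infimum over an uncountable set; its Lipschitz continuity
   reduces measurability to countably many rational vectors. *)
Lemma measurable_knot_dist_lt j (t : R) :
  measurable [set w | (knot_dist j (Y ^~ w) < t%:E)%E].
Proof.
pose qv (q : {ffun 'I_n -> rat}) (i : nat) : R :=
  if insub i is Some i' then ratr (q i') else 0.
(* [B q] is the event on which the Lipschitz bound through the rational vector [q] already certifies
   the inequality. *)
pose B q := [set w | (knot_dist j (qv q) +
  (knot_norm n (fun i => Y i w - qv q i))%:E < t%:E)%E].
have -> : [set w | (knot_dist j (Y ^~ w) < t%:E)%E] = \bigcup_q B q.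
  apply/seteqP; split => w /=; last first.
    by move=> [q _]; apply: le_lt_trans; exact: knot_dist_lipschitz.
  move=> Ft.
  have Ffin : knot_dist j (Y ^~ w) \is a fin_num.
    by rewrite ge0_fin_numE ?knot_dist_ge0// (lt_le_trans Ft)// leey.
  have eF : knot_dist j (Y ^~ w) = (fine (knot_dist j (Y ^~ w)))%:E by rewrite fineK.
  move: Ft; rewrite eF lte_fin => Ft.
  (* Passing from [Y] to [q] and back costs [2 * e], which leaves a margin [e] below
     [t = F + 3 * e]. *)
  set F := fine _ in eF Ft; pose e := (t - F) / 3.
  have e0 : 0 < e by rewrite divr_gt0// subr_gt0.
  have hq (i : 'I_n) : {q : rat | `|Y i w - ratr q| <= e}.
    apply: cid; have [|q] := @rat_in_itvoo R (Y i w - e) (Y i w + e); first by lra.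
    rewrite in_itv/= => /andP[q1 q2]; exists q; rewrite ler_norml.
    by apply/andP; split; lra.
  pose q := [ffun i => projT1 (hq i)]; exists q => //.
  have dq : knot_norm n (fun i => Y i w - qv q i) <= e.
    apply: knot_norm_le_bound => //; first exact: ltW.
    move=> i lin; rewrite /qv insubT/= ffunE; exact: (projT2 (hq (Ordinal lin))).
  have dq' : knot_norm n (fun i => qv q i - Y i w) <= e.
    rewrite -knot_normN; apply: le_trans dq; rewrite le_eqVlt; apply/orP; left.
    by apply/eqP/eq_knot_norm => i _; rewrite opprB.
  rewrite /B/=.
  apply: le_lt_trans (leeD (knot_dist_lipschitz j _ (Y ^~ w)) (le_refl _)) _.
  rewrite eF -!EFinD lte_fin.
  have et : t = F + 3 * e by rewrite /e; field.
  by rewrite et; lra.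
apply: countable_bigcupT_measurable; first exact: countableP.
move=> q; rewrite -[B q]setTI; apply: emeasurable_fun_infty_o => //.
apply: emeasurable_funD; first exact: measurable_cst.
exact/measurable_EFinP/measurable_knot_norm.
Qed.

End Measurability.
End Smode.

(** * A maximal inequality for products of independent variables *)

Section IndependentProducts.
Context d (Omega : measurableType d) (R : realType) (P : probability Omega R).

(** The joint law agrees with the product of the laws on rectangles, hence everywhere; Tonelli then
    factors the integral. *)
Lemma ge0_expectation_mul_indep (V Y : Omega -> R) :
    measurable_fun setT V -> measurable_fun setT Y ->
    (forall w, 0 <= V w) -> (forall w, 0 <= Y w) ->
    (forall A B, measurable A -> measurable B ->
      P (V @^-1` A `&` Y @^-1` B) = (P (V @^-1` A) * P (Y @^-1` B))%E) ->
  (\int[P]_w (V w * Y w)%:E = \int[P]_w (V w)%:E * \int[P]_w (Y w)%:E)%E.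
Proof.
move=> mV mY V0 Y0 VY.
pose V' : {mfun Omega >-> R} := HB.pack V (isMeasurableFun.Build _ _ _ _ _ mV).
pose Y' : {mfun Omega >-> R} := HB.pack Y (isMeasurableFun.Build _ _ _ _ _ mY).
have mVY : measurable_fun setT (fun w => (V w, Y w)) by exact: measurable_fun_pair.
pose VY' : {mfun Omega >-> (R * R)%type} :=
  HB.pack (fun w => (V w, Y w)) (isMeasurableFun.Build _ _ _ _ _ mVY).
(* Absolute values make the integrand nonnegative on the whole plane without changing it on the
   range of [(V, Y)]. *)
pose f (z : R * R) : \bar R := (`|z.1| * `|z.2|)%:E.
have mf : measurable_fun setT f.
  apply/measurable_EFinP; apply: measurable_funM.
    exact: measurableT_comp.
  exact: measurableT_comp.
have f0 z : (0 <= f z)%E by rewrite lee_fin mulr_ge0.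
have -> : (\int[P]_w (V w * Y w)%:E = \int[distribution P VY']_z f z)%E.
  rewrite ge0_integral_distribution//; apply: eq_integral => w _ /=.
  by rewrite /f/= !ger0_norm.
have E (A : set (R * R)) : measurable A ->
    (distribution P V' \x distribution P Y')%E A = distribution P VY' A.
  apply: product_measure_unique => A1 B1 mA mB.
  by rewrite /distribution/= /pushforward/= -VY.
rewrite (eq_measure_integral (distribution P V' \x distribution P Y')%E);
  last by move=> A mA _; exact: esym (E A mA).
rewrite fubini_tonelli1//.
have intn (Z : {mfun Omega >-> R}) : (forall w, 0 <= Z w) ->
    (\int[distribution P Z]_x `|x|%:E = \int[P]_w (Z w)%:E)%E.
  move=> Z0; rewrite ge0_integral_distribution//.
    by apply: eq_integral => w _ /=; rewrite ger0_norm.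
  by apply/measurable_EFinP; exact: normr_measurable.
rewrite /fubini_F/=.
under eq_integral => x _.
  rewrite /f/=; under eq_integral do rewrite EFinM.
  rewrite ge0_integralZl//; last first.
    by apply/measurable_EFinP; exact: normr_measurable.
  rewrite (intn Y')//; over.
rewrite ge0_integralZr//; last 2 first.
- by apply/measurable_EFinP; exact: normr_measurable.
- by apply: integral_ge0 => w _; rewrite lee_fin.
by rewrite (intn V').
Qed.

(** Both sides are finite measures in [A]: a restriction of [P] and a multiple of [P]. Agreeing on
    the pi-system [G], they agree on the sigma-algebra it generates. *)
Lemma indep_g_sigma_algebra (G : set (set Omega)) (C : set Omega) :
    G `<=` measurable -> G setT -> setI_closed G -> measurable C ->
    (forall A, G A -> P (A `&` C) = (P A * P C)%E) ->
  forall A, <<s G >> A -> P (A `&` C) = (P A * P C)%E.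
Proof.
move=> Gm GT GI mC GC A sGA.
have PC0 : 0 <= fine (P C) by rewrite fine_ge0.
pose r : {nonneg R} := NngNum PC0.
have mE B : mscale r P B = (P B * P C)%E.
  by rewrite /mscale/= fineK ?fin_num_measure// muleC.
rewrite -mE -/(mrestr P mC A).
apply: (@g_sigma_algebra_measure_unique _ _ _ G Gm (fun _ => setT)) => //.
- by rewrite bigcup_const//; exists 0%N.
- by move=> B GB; rewrite [RHS]mE; exact: GC.
- move=> _; apply: (@le_lt_trans _ _ 1%E); last exact: ltry.
  by apply: probability_le1; exact: measurableI.
Qed.

End IndependentProducts.

(** * Maximal inequality by stopping a product supermartingale *)

Section MaximalInequality.
Context d (Omega : measurableType d) (R : realType) (P : probability Omega R).
Implicit Types (X : nat -> Omega -> R).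

(** Initial segments suffice, because a factor is removed by choosing [B i = setT]. *)
Definition independent_upto (n : nat) X := forall m (B : nat -> set R),
  (m <= n)%N -> (forall i, measurable (B i)) ->
  P (\big[setI/setT]_(i < m) (X i @^-1` B i)) =
    (\prod_(i < m) P (X i @^-1` B i))%E.

Lemma independent_upto_comp (n : nat) X (phi : R -> R) :
  measurable_fun setT phi -> independent_upto n X ->
  independent_upto n (fun i => phi \o X i).
Proof.
move=> mphi iX m B mn mB.
apply: (iX m (fun i => phi @^-1` B i) mn) => i.
by rewrite -[_ @^-1` _]setTI; exact: mphi.
Qed.

(** A pi-system generating the past of the process before time [m]. *)
Definition cylinders X (m : nat) : set (set Omega) :=
  [set A | exists2 B : nat -> set R, forall i, measurable (B i) &
    A = \big[setI/setT]_(i < m) (X i @^-1` B i)].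

(* The running product of the X i, frozen as soon as it reaches a. *)
Fixpoint frozen_product (a : R) X (m : nat) (w : Omega) : R :=
  if m is m'.+1 then
    let u := frozen_product a X m' w in
    u + (u * \1_(`]-oo, a[%classic) u) * (X m' w - 1)
  else 1.

Section FrozenProduct.
Variables (n : nat) (X : nat -> Omega -> R) (a : R).
Hypotheses (mX : forall i, measurable_fun setT (X i)) (iX : independent_upto n X).
Hypotheses (X0 : forall i w, 0 <= X i w).
Hypotheses (X1 : forall i, (i < n)%N -> (\int[P]_w (X i w)%:E <= 1)%E).
Hypothesis a_gt0 : 0 < a.

Let U := frozen_product a X.

(** The part of the process still running. One step replaces [U m] by
    [(U m - below (U m)) + below (U m) * X m], a sum of nonnegative terms. *)
Let below (u : R) : R := u * \1_(`]-oo, a[%classic) u.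

Let belowE u : below u = if u < a then u else 0.
Proof.
rewrite /below indicE; have [ua|ua] := ltP u a.
  by rewrite mem_set ?mulr1//= in_itv.
by rewrite memNset ?mulr0//= in_itv/= ltNge ua.
Qed.

Let measurable_below : measurable_fun setT below.
Proof. by apply: measurable_funM => //; exact: measurable_indic. Qed.

Let US m w : U m.+1 w = U m w + below (U m w) * (X m w - 1).
Proof. by []. Qed.

Let U_ge0 m w : 0 <= U m w.
Proof.
elim: m => [|m IH] //; rewrite US belowE; case: ifP => _.
  by rewrite mulrBr mulr1 addrCA subrr addr0 mulr_ge0.
by rewrite mul0r addr0.
Qed.

Let U_frozen m p w : (m <= p)%N -> a <= U m w -> a <= U p w.
Proof.
move=> /subnK <-; elim: (p - m)%N => [//|k IH] am.
by rewrite addSn US belowE ltNge IH//= mul0r addr0 IH.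
Qed.

(** By [U_frozen], a value below [a] rules out any earlier freezing, so every factor has been
    multiplied in. *)
Let U_prod m w : U m w < a -> U m w = \prod_(i < m) X i w.
Proof.
elim: m => [|m IH] Ua; first by rewrite big_ord0.
have Uma : U m w < a.
  by rewrite ltNge; apply/negP => /(U_frozen (leqnSn m)); rewrite leNgt Ua.
by rewrite big_ord_recr/= -IH// US belowE Uma; ring.
Qed.

Let cylinders_measurable m : cylinders X m `<=` measurable.
Proof.
move=> _ [B mB ->]; apply: bigsetI_measurable => i _.
by rewrite -[_ @^-1` _]setTI; exact: mX.
Qed.

Let cylindersT m : cylinders X m setT.
Proof. by exists (fun=> setT) => //; rewrite big1. Qed.

Let cylindersI m : setI_closed (cylinders X m).
Proof.
move=> _ _ [B mB ->] [C mC ->]; exists (fun i => B i `&` C i).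
  by move=> i; exact: measurableI.
by rewrite -big_split/=.
Qed.

(** The condition [C] is appended as coordinate [m]; independence at lengths [m.+1] and [m] is then
    compared. *)
Let cylinders_indep m A C : (m < n)%N -> measurable C -> cylinders X m A ->
  P (A `&` X m @^-1` C) = (P A * P (X m @^-1` C))%E.
Proof.
move=> mn mC [B mB ->].
pose B' i := if (i < m)%N then B i else C.
have mB' i : measurable (B' i) by rewrite /B'; case: ifP.
have e1 : \big[setI/setT]_(i < m) (X i @^-1` B i) =
    \big[setI/setT]_(i < m) (X i @^-1` B' i).
  by apply: eq_bigr => i _; rewrite /B' ltn_ord.
have eC : C = B' m by rewrite /B' ltnn.
have := iX mn mB'; rewrite !big_ord_recr/= -eC e1 => ->.
by rewrite (iX (ltnW mn) mB').
Qed.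

Let sub_cylinders i m : (i < m)%N ->
  measurable_fun setT (X i : g_sigma_algebraType (cylinders X m) -> R).
Proof.
move=> im _ C mC; rewrite setTI; apply: sub_sigma_algebra.
exists (fun k => if k == i then C else setT).
  by move=> k; case: ifP.
rewrite (bigD1 (Ordinal im))//= eqxx big1 ?setIT// => k ki.
by case: ifP => // /eqP ki'; case/eqP: ki; exact: val_inj.
Qed.

Let measurable_U_cylinders m p : (m <= p)%N ->
  measurable_fun setT (U m : g_sigma_algebraType (cylinders X p) -> R).
Proof.
elim: m => [|m IH] mp; first exact: measurable_cst.
have mU := IH (ltnW mp).
apply: measurable_funD => //; apply: measurable_funM.
  exact: (measurableT_comp measurable_below mU).
by apply: measurable_funB => //; exact: sub_cylinders.
Qed.

Let measurable_U m : measurable_fun setT (U m).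
Proof.
elim: m => [|m IH]; first exact: measurable_cst.
apply: measurable_funD => //; apply: measurable_funM.
  exact: (measurableT_comp measurable_below IH).
exact: measurable_funB.
Qed.

(** [U m] is a function of the variables before [m], so independence from [X m] passes from
    cylinders to its level sets. *)
Let indep_U m (A C : set R) : (m < n)%N -> measurable A -> measurable C ->
  P ((below \o U m) @^-1` A `&` X m @^-1` C) =
    (P ((below \o U m) @^-1` A) * P (X m @^-1` C))%E.
Proof.
move=> mn mA mC.
apply: (@indep_g_sigma_algebra _ _ _ P (cylinders X m)) => //.
- by rewrite -[_ @^-1` _]setTI; exact: mX.
- by move=> D; exact: cylinders_indep.
- have := measurableT_comp measurable_below (measurable_U_cylinders (leqnn m)).
  by move=> /(_ measurableT _ mA); rewrite setTI.
Qed.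

(** Supermartingale property: the running part is independent of [X m], whose mean is at most one,
    so multiplying by [X m] cannot raise the expectation. *)
Let expectation_U m : (m <= n)%N -> (\int[P]_w (U m w)%:E <= 1)%E.
Proof.
elim: m => [|m IH] mn.
  by rewrite (integral_cst P measurableT 1) mul1e probability_le1.
apply: le_trans (IH (ltnW mn)).
have b0 w : 0 <= below (U m w) by rewrite belowE; case: ifP.
have r0 w : 0 <= U m w - below (U m w).
  by rewrite belowE; case: ifP => _; rewrite ?subrr ?subr0.
have mb : measurable_fun setT (below \o U m) by exact: measurableT_comp.
under eq_integral => w _.
  have -> : (U m.+1 w)%:E =
      ((U m w - below (U m w))%:E + (below (U m w) * X m w)%:E)%E.
    by rewrite US -EFinD; congr EFin; ring.
  over.
rewrite ge0_integralD//=; last 4 first.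
- by move=> w _; rewrite lee_fin.
- by apply/measurable_EFinP; exact: measurable_funB.
- by move=> w _; rewrite lee_fin mulr_ge0.
- by apply/measurable_EFinP; exact: measurable_funM.
rewrite (@ge0_expectation_mul_indep _ _ _ P (below \o U m) (X m))//; last first.
  by move=> A C mA mC; exact: indep_U.
have -> : (\int[P]_w (U m w)%:E = \int[P]_w (U m w - below (U m w))%:E +
    \int[P]_w ((below \o U m) w)%:E)%E.
  rewrite -ge0_integralD//=.
  - by apply: eq_integral => w _; rewrite -EFinD subrK.
  - by move=> w _; rewrite lee_fin.
  - by apply/measurable_EFinP; exact: measurable_funB.
  - by move=> w _; rewrite lee_fin.
  - exact/measurable_EFinP.
apply: leeD => //; rewrite -[leRHS]mule1; apply: lee_pmul => //.
- by apply: integral_ge0 => w _; rewrite lee_fin; exact: b0.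
- by apply: integral_ge0 => w _; rewrite lee_fin; exact: X0.
- exact: X1.
Qed.

(** If some product up to time [n] reaches [a], then [U n] is at least [a]. Markov's inequality for
    [U n] alone therefore controls all times at once. *)
Lemma prod_maximal_ineq :
  (a%:E * P (\bigcup_(m in [set m | (m <= n)%N])
               [set w | (a <= \prod_(i < m) X i w)%R]) <= 1)%E.
Proof.
apply: le_trans (expectation_U (leqnn n)).
have mE : measurable [set w | a <= U n w].
  rewrite -[X in measurable X]setTI.
  by apply: measurable_fun_le => //; exact: measurable_cst.
have sE : \bigcup_(m in [set m | (m <= n)%N])
    [set w | a <= \prod_(i < m) X i w] `<=` [set w | a <= U n w].
  move=> w [m mn] /= am; apply: (U_frozen mn); rewrite leNgt; apply/negP => Ua.
  by have := Ua; rewrite (U_prod Ua) ltNge am.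
apply: (@le_trans _ _ (a%:E * P [set w | (a <= U n w)%R])%E).
  apply: lee_wpmul2l; first by rewrite lee_fin ltW.
  apply: le_measure => //; rewrite inE; last exact: mE.
  apply: bigcup_measurable => m _; rewrite -[X in measurable X]setTI.
  by apply: measurable_fun_le => //; apply: measurable_prod => i _.
have mUn : measurable_fun setT (EFin \o U n) by exact/measurable_EFinP.
have := @le_integral_comp_abse _ _ _ P setT measurableT (EFin \o U n) a id
  (@measurable_id _ _ _) (fun _ => id) (fun _ _ _ _ => id) mUn a_gt0.
rewrite setTI; congr (_ * P _ <= _)%E.
- apply/seteqP; split => w /=; rewrite lee_fin ger0_norm//.
- by apply: eq_integral => w _ /=; rewrite ger0_norm.
Qed.

End FrozenProduct.
End MaximalInequality.

(** Independence is applied to the set of ordinals below [m]. Re-indexing by [inord] needs an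
    inhabited ordinal type, hence [n.+1]. *)
Lemma independent_upto_inord d (Omega : measurableType d) (R : realType)
    (P : probability Omega R) (n : nat) (X : 'I_n.+1 -> Omega -> R) :
  mutually_independent P X -> independent_upto P n.+1 (fun i => X (inord i)).
Proof.
move=> iX m B mn mB; have := iX [set i : 'I_n.+1 | (i < m)%N]%SET (B \o val).
have inJ (i : 'I_n.+1) : (i \in [set i : 'I_n.+1 | (i < m)%N]%SET) = (i < m)%N.
  by rewrite inE.
rewrite !(eq_bigl _ _ inJ) => /(_ (fun i => mB i)).
rewrite (big_ord_widen_cond n.+1 xpredT (fun i => X (inord i) @^-1` B i)) //.
rewrite (big_ord_widen_cond n.+1 xpredT (fun i => P (X (inord i) @^-1` B i)))//.
move=> h; transitivity (P (\big[setI/setT]_(i < n.+1 | (i < m)%N)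
    (X i @^-1` (B \o val) i))).
  by congr (P _); apply: eq_bigr => i _; rewrite inord_val.
by rewrite h; apply: eq_bigr => i _; rewrite inord_val.
Qed.

(** * Bernstein's maximal inequality *)

Section MomentGeneratingFunction.

Lemma geometric_sum_le (R : realType) (q : R) (N : nat) :
  0 <= q < 1 -> \sum_(i < N) q ^+ i <= (1 - q)^-1.
Proof.
move=> /andP[q0 q1]; have q1' : 0 < 1 - q by rewrite subr_gt0.
rewrite -[leRHS]mul1r ler_pdivlMr// mulrC -opprB mulNr -subrX1 opprB.
by rewrite lerBlDr lerDl exprn_ge0.
Qed.

(** In the exponential series the terms of order at least two are replaced by their absolute values.
    A nonnegative extended-real series can then be integrated term by term. *)
Lemma expR_le_1D_nneseries (R : realType) (y : R) :
  ((expR y)%:E <=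
   (1 + y)%:E + \sum_(m <oo) (`|y| ^+ m.+2 / (m.+2)`!%:R)%:E)%E.
Proof.
set G := (\sum_(m <oo) _)%E.
have G_ge N : ((\sum_(m < N) (`|y| ^+ m.+2 / (m.+2)`!%:R))%:E <= G)%E.
  rewrite -sumEFin -(big_mkord xpredT (fun m => (`|y| ^+ m.+2 / (m.+2)`!%:R)%:E)).
  by apply: nneseries_lim_ge => m _ _; rewrite lee_fin divr_ge0.
have [->|Goo] := eqVneq G +oo%E; first by rewrite addey// leey.
have G0 : (0 <= G)%E by have := G_ge 0%N; rewrite big_ord0.
have Gfin : G \is a fin_num by rewrite ge0_fin_numE// ltey.
rewrite -(fineK Gfin) -EFinD lee_fin.
apply: limr_le; first exact: is_cvg_series_exp_coeff.
near=> N; have N2 : (2 <= N)%N by near: N; exists 2%N.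
(* The terms of order zero and one are split off; the others are compared after a shift by two. *)
rewrite -(subnK N2) addn2 /series/= big_mkord 2!big_ord_recl/=.
rewrite /exp_coeff/= expr0 fact0 factS fact0 muln1 !divr1 expr1 addrA lerD2l.
have := G_ge (N - 2)%N; rewrite -(fineK Gfin) lee_fin; apply: le_trans.
apply: ler_sum => i _; rewrite /bump/= !add1n ler_pM2r ?invr_gt0 ?ltr0n ?fact_gt0//.
by rewrite -normrX ler_norm.
Unshelve. all: by end_near. Qed.

Context d (Omega : measurableType d) (R : realType) (P : probability Omega R).

(** Domination by [1 + |X|^2]. *)
Lemma integrable_of_second_moment (X : Omega -> R) (v : R) :
  measurable_fun setT X -> (\int[P]_w (`|X w| ^+ 2)%:E <= v%:E)%E ->
  P.-integrable setT (EFin \o X).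
Proof.
move=> mX X2.
have mX2 : measurable_fun setT (fun w => `|X w| ^+ 2).
  by apply: measurable_funX; exact: measurableT_comp.
have i2 : P.-integrable setT (fun w => (1 + `|X w| ^+ 2)%:E).
  apply/integrableP; split.
    by apply/measurable_EFinP; exact: measurable_funD.
  under eq_integral do rewrite gee0_abs ?lee_fin ?addr_ge0// EFinD.
  rewrite ge0_integralD//; last exact/measurable_EFinP.
  apply: lte_add_pinfty; last by apply: le_lt_trans X2 _; rewrite ltry.
  rewrite (integral_cst P measurableT 1) mul1e.
  by apply: le_lt_trans (probability_le1 _ _) _; rewrite ?ltry.
apply: le_integrable i2 => //; first exact/measurable_EFinP.
move=> w _ /=; rewrite lee_fin [leRHS]ger0_norm ?addr_ge0//.
have := sqr_ge0 (`|X w| - 1); rewrite !expr2 => h.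
have := normr_ge0 (X w); nra.
Qed.

(** Mean zero removes the linear term. In the term of order [m + 2] the moment bound cancels the
    factorial, leaving a geometric series of ratio [lam * kappa]. *)
Lemma bernstein_mgf (X : Omega -> R) (kappa v lam : R) :
    measurable_fun setT X -> 0 < kappa -> 0 < v -> 0 <= lam -> lam * kappa < 1 ->
    (\int[P]_w (X w)%:E = 0)%E ->
    (forall m, (2 <= m)%N -> (\int[P]_w (`|X w| ^+ m)%:E <=
      (v * m`!%:R * kappa ^+ (m - 2) / 2)%:E)%E) ->
  (\int[P]_w (expR (lam * X w))%:E <=
    (1 + lam ^+ 2 * v / (2 * (1 - lam * kappa)))%:E)%E.
Proof.
move=> mX k0 v0 l0 lk X0 Xm.
pose g m w : \bar R := (`|lam * X w| ^+ m.+2 / (m.+2)`!%:R)%:E.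
pose G w := (\sum_(m <oo) g m w)%E.
have g0 m w : (0 <= g m w)%E by rewrite lee_fin divr_ge0.
have mlX : measurable_fun setT (fun w => lam * X w).
  exact: measurable_funM.
have mg m : measurable_fun setT (g m).
  apply/measurable_EFinP; apply: measurable_funM => //.
  by apply: measurable_funX; exact: measurableT_comp.
have G0 w : (0 <= G w)%E by apply: nneseries_ge0.
have mG : measurable_fun setT G.
  by apply: (@ge0_emeasurable_sum _ _ _ setT g xpredT).
have iX : P.-integrable setT (EFin \o X).
  apply: (@integrable_of_second_moment _ v) => //.
  apply: le_trans (Xm 2%N _) _ => //.
  by rewrite subnn expr0 mulr1 lee_fin !factS fact0 !muln1 mulfK.
have ig m : (\int[P]_w g m w <= (lam ^+ 2 * v / 2 * (lam * kappa) ^+ m)%:E)%E.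
  have -> : (\int[P]_w g m w =
      (lam ^+ m.+2 / (m.+2)`!%:R)%:E * \int[P]_w (`|X w| ^+ m.+2)%:E)%E.
    rewrite -ge0_integralZl//; last 2 first.
    - by apply/measurable_EFinP/measurable_funX; exact: measurableT_comp.
    - by rewrite lee_fin divr_ge0// exprn_ge0.
    apply: eq_integral => w _; rewrite /g -EFinM normrM exprMn (ger0_norm l0).
    by congr EFin; ring.
  apply: (@le_trans _ _ ((lam ^+ m.+2 / (m.+2)`!%:R)%:E *
      (v * (m.+2)`!%:R * kappa ^+ m / 2)%:E)%E).
    apply: lee_wpmul2l; first by rewrite lee_fin divr_ge0// exprn_ge0.
    by have := Xm m.+2 isT; rewrite subSS subSS subn0.
  rewrite -EFinM lee_fin le_eqVlt; apply/orP; left; apply/eqP.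
  rewrite exprMn -[m.+2]addn2 exprD; field.
  by rewrite pnatr_eq0 -lt0n fact_gt0.
have q1 : 0 < 1 - lam * kappa by rewrite subr_gt0.
have q01 : 0 <= lam * kappa < 1 by rewrite lk mulr_ge0// ltW.
have iG : (\int[P]_w G w <= (lam ^+ 2 * v / (2 * (1 - lam * kappa)))%:E)%E.
  rewrite integral_nneseries//.
  apply: lime_le.
    by apply: is_cvg_nneseries => m _ _; apply: integral_ge0 => w _; exact: g0.
  apply: nearW => N.
  apply: (@le_trans _ _ (\sum_(0 <= m < N)
      (lam ^+ 2 * v / 2 * (lam * kappa) ^+ m)%:E)%E).
    by apply: lee_sum => m _; exact: ig.
  rewrite sumEFin lee_fin -mulr_sumr big_mkord invfM mulrA ler_wpM2l//.
    by rewrite divr_ge0// mulr_ge0// ?sqr_ge0// ltW.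
  exact: geometric_sum_le.
have integrableG : P.-integrable setT G.
  apply/integrableP; split => //.
  rewrite (eq_integral G); last by move=> w _; rewrite gee0_abs.
  by apply: le_lt_trans iG _; rewrite ltry.
have i1 : P.-integrable setT (cst 1%:E : Omega -> \bar R).
  exact: finite_measure_integrable_cst.
have ilX : P.-integrable setT (fun w => (lam%:E * (X w)%:E)%E).
  exact: integrableZl.
have i1X : P.-integrable setT (fun w => (1 + lam * X w)%:E).
  exact: eq_integrable (integrableD measurableT i1 ilX).
apply: (@le_trans _ _ (\int[P]_w ((1 + lam * X w)%:E + G w))%E).
  apply: ge0_le_integral => //.
  - by apply/measurable_EFinP; exact: measurableT_comp.
  - apply: emeasurable_funD => //; exact: measurable_int i1X.
  - by move=> w _; exact: expR_le_1D_nneseries.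
rewrite integralD// EFinD; apply: leeD => //.
have -> : (\int[P]_w (1 + lam * X w)%:E =
    \int[P]_w (cst 1%:E w) + \int[P]_w (lam%:E * (X w)%:E))%E.
  by rewrite -integralD//; apply: eq_integral.
rewrite (integral_cst P measurableT 1) mul1e integralZl// X0 mule0 adde0.
exact: probability_le1.
Qed.

End MomentGeneratingFunction.

Section BernsteinMaximal.
Context d (Omega : measurableType d) (R : realType) (P : probability Omega R).
Variables (n : nat) (X : nat -> Omega -> R) (kappa v : R).
Hypotheses (n_gt0 : (0 < n)%N) (kappa_gt0 : 0 < kappa) (v_gt0 : 0 < v).
Hypotheses (mX : forall i, measurable_fun setT (X i)).

(** The variables [expR (lam * X i) / psi] are nonnegative with mean at most one, so
    [prod_maximal_ineq] applies to their products. *)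
Lemma bernstein_maximal (x : R) :
    independent_upto P n X ->
    (forall i, (i < n)%N -> (\int[P]_w (X i w)%:E = 0)%E) ->
    (forall i m, (i < n)%N -> (2 <= m)%N -> (\int[P]_w (`|X i w| ^+ m)%:E <=
      (v * m`!%:R * kappa ^+ (m - 2) / 2)%:E)%E) ->
    0 < x ->
  (P (\bigcup_(m in [set m | (m <= n)%N])
        [set w | (x <= \sum_(i < m) X i w)%R]) <=
   (expR (- (x ^+ 2 / (2 * (n%:R * v + kappa * x)))))%:E)%E.
Proof.
move=> iX X0 Xm x0.
have n0 : 0 < n%:R :> R by rewrite ltr0n.
pose D := n%:R * v + kappa * x.
have D0 : 0 < D by rewrite addr_gt0// mulr_gt0.
(* This [lam] gives [1 - lam * kappa = n * v / D], so that [n * q] is exactly half of [lam * x]. *)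
pose lam := x / D; pose q := lam ^+ 2 * v / (2 * (1 - lam * kappa)).
have l0 : 0 <= lam by rewrite divr_ge0// ltW.
have elk : 1 - lam * kappa = n%:R * v / D.
  by rewrite /lam /D; field; rewrite gt_eqF.
have lk : lam * kappa < 1 by rewrite -subr_gt0 elk divr_gt0// mulr_gt0.
have q0 : 0 <= q.
  apply: divr_ge0; apply: mulr_ge0 => //; [exact: sqr_ge0|exact: ltW|].
  by rewrite subr_ge0 ltW.
have nq : n%:R * q = x ^+ 2 / (2 * D).
  rewrite /q elk /lam; field.
  by rewrite !gt_eqF.
have lx : lam * x = x ^+ 2 / D by rewrite /lam expr2; ring.
pose psi := 1 + q; have psi0 : 0 < psi by rewrite ltr_pwDl.
pose phi y := expR (lam * y) * psi^-1.
have mphi : measurable_fun setT phi.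
  by apply: measurable_funM => //; exact: measurableT_comp.
pose a := expR (lam * x) / psi ^+ n.
have a0 : 0 < a by rewrite divr_gt0 ?expR_gt0 ?exprn_gt0.
have mxi i : measurable_fun setT (phi \o X i) by exact: measurableT_comp.
have xi0 i w : 0 <= (phi \o X i) w by rewrite /= mulr_ge0 ?expR_ge0 ?invr_ge0 ?ltW.
have xi1 i : (i < n)%N -> (\int[P]_w ((phi \o X i) w)%:E <= 1)%E.
  move=> lin; have mgf : (\int[P]_w (expR (lam * X i w))%:E <= psi%:E)%E.
    apply: bernstein_mgf => //; first exact: X0.
    by move=> m m2; exact: Xm.
  rewrite (eq_integral (fun w => ((expR (lam * X i w))%:E * (psi^-1)%:E)%E))//.
  rewrite ge0_integralZr//; last 2 first.
  - apply/measurable_EFinP; apply: measurableT_comp => //; exact: measurable_funM.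
  - by rewrite lee_fin invr_ge0 ltW.
  apply: (@le_trans _ _ (psi%:E * (psi^-1)%:E)%E).
    by apply: lee_wpmul2r => //; rewrite lee_fin invr_ge0 ltW.
  by rewrite -EFinM divff// gt_eqF.
have := prod_maximal_ineq mxi (independent_upto_comp mphi iX) xi0 xi1 a0.
set E2 := (X in P X); set E1 := (X in (P X <= _)%E).
have mE1 : measurable E1.
  apply: bigcup_measurable => m _; rewrite -[X in measurable X]setTI.
  by apply: measurable_fun_le => //; exact: measurable_sum.
have mE2 : measurable E2.
  apply: bigcup_measurable => m _; rewrite -[X in measurable X]setTI.
  by apply: measurable_fun_le => //; apply: measurable_prod => i _.
(* Since [psi >= 1], dividing by [psi ^+ m] with [m <= n] costs at most [psi ^+ n]; one level [a]
   thus serves every [m]. *)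
have E12 : E1 `<=` E2.
  move=> w [m mn /= xS]; exists m => //=.
  rewrite big_split/= prodr_const card_ord -expR_sum -mulr_sumr exprVn.
  apply: ler_pM; [exact: expR_ge0|by rewrite invr_ge0 exprn_ge0// ltW| |].
    by rewrite ler_expR ler_wpM2l.
  rewrite lef_pV2 ?posrE ?exprn_gt0//; apply: ler_weXn2l => //.
  by rewrite lerDl.
move=> aE2; apply: (@le_trans _ _ (a^-1)%:E); last first.
  rewrite lee_fin /a invfM invrK -expRN.
  (* Here [(1 + q) ^+ n] is bounded by [expR (n * q)]. *)
  apply: (@le_trans _ _ (expR (- (lam * x)) * expR (n%:R * q))).
    rewrite ler_wpM2l ?expR_ge0// expRM_natl.
    apply: lerXn2r; rewrite ?nnegrE ?expR_ge0 ?(ltW psi0)//.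
    exact: expR_ge1Dx.
  rewrite -expRD ler_expR lx nq -/D.
  rewrite le_eqVlt; apply/orP; left; apply/eqP; field.
  by rewrite gt_eqF.
apply: (@le_trans _ _ (P E2)); first by apply: le_measure; rewrite ?inE.
by rewrite -[leRHS]mul1e lee_pdivlMr// muleC.
Qed.

End BernsteinMaximal.

(** * The threshold as the root of a quadratic equation *)

Section Threshold.
Variables (R : realType) (n : nat) (kappa v : R).
Hypotheses (n_gt0 : (0 < n)%N) (kappa_gt0 : 0 < kappa) (v_gt0 : 0 < v).

Lemma tau_gt0 (beta : R) : 0 < beta < 1 -> 0 < tau n kappa v beta.
Proof.
move=> /andP[b0 b1]; have n0 : 0 < n%:R :> R by rewrite ltr0n.
have L0 : ln (beta / 2) < 0 by rewrite ln_lt0// divr_gt0//= ltr_pdivrMr//; lra.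
rewrite divr_gt0// subr_gt0 (@lt_le_trans _ _ 0)//.
by rewrite pmulr_rlt0.
Qed.

(** With [L = ln (beta / 2)], [x] is the positive root of [x^2 + 2 L kappa x + 2 L n v = 0];
    completing the square yields the radicand of [tau]. The Bernstein bound at [x] thus equals
    [beta / 2]. *)
Lemma tau_exponent (beta : R) : 0 < beta < 1 ->
  let x := n%:R * tau n kappa v beta in
  x ^+ 2 / (2 * (n%:R * v + kappa * x)) = - ln (beta / 2).
Proof.
move=> b01 x; have t0 := tau_gt0 b01; move: b01 => /andP[b0 b1].
have n0 : 0 < n%:R :> R by rewrite ltr0n.
have L0 : ln (beta / 2) < 0 by rewrite ln_lt0// divr_gt0//= ltr_pdivrMr//; lra.
have x0 : 0 < x by rewrite mulr_gt0.
have d0 : 0 < n%:R * v + kappa * x by rewrite addr_gt0// mulr_gt0.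
set L := ln (beta / 2) in L0.
have rad0 : 0 <= L * (L * kappa ^+ 2 - 2 * n%:R * v).
  rewrite mulr_le0// ?ltW// subr_lt0.
  apply: (@lt_trans _ _ 0); first by rewrite nmulr_rlt0// exprn_gt0.
  by rewrite !mulr_gt0.
have ex : x + kappa * L = Num.sqrt (L * (L * kappa ^+ 2 - 2 * n%:R * v)).
  by rewrite /x /tau -/L; field; rewrite gt_eqF.
have sq : (x + kappa * L) ^+ 2 = L * (L * kappa ^+ 2 - 2 * n%:R * v).
  by rewrite ex sqr_sqrtr.
rewrite (_ : x ^+ 2 = - L * (2 * (n%:R * v + kappa * x))).
  by rewrite mulfK// gt_eqF// mulr_gt0.
by move: sq; rewrite !expr2 => sq; nra.
Qed.

End Threshold.

(** * The number of modes *)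

(** The value is [m] when [m] is the maximum, and also for [m = 0] when there is no maximum and
    [xget] returns its default. *)
Lemma measurable_xget_max d (Omega : measurableType d) (A : Omega -> set nat) :
  (forall j, measurable [set w | A w j]) ->
  forall m, measurable [set w | xget 0%N (is_max_nat (A w)) = m].
Proof.
move=> mA m.
have mmax p : measurable [set w | is_max_nat (A w) p].
  have -> : [set w | is_max_nat (A w) p] = [set w | A w p] `&`
     \bigcap_(j in [set j | (p < j)%N]) ~` [set w | A w j].
    apply/seteqP; split => w /= [Ap h]; split => //.
      by move=> j /= pj /h; rewrite leqNgt pj.
    by move=> j Aj; rewrite leqNgt; apply/negP => pj; exact: (h j pj).
  apply: measurableI => //; apply: bigcap_measurableType => j _.
  exact: measurableC.
have uniq w p q : is_max_nat (A w) p -> is_max_nat (A w) q -> p = q.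
  by move=> [Ap hp] [Aq hq]; apply/eqP; rewrite eqn_leq hp// hq.
have -> : [set w | xget 0%N (is_max_nat (A w)) = m] =
    [set w | is_max_nat (A w) m] `|`
    (if m == 0%N then ~` \bigcup_p [set w | is_max_nat (A w) p] else set0).
  apply/seteqP; split => w /=.
    case: xgetP => [p pE hp pm|hN m0]; first by left; rewrite -pm.
    by right; rewrite -m0 /= => -[p _ /hN].
  case=> [hm|]; first by apply: xget_unique => // y /uniq /(_ hm).
  case: eqP => // -> hN; apply: xgetPN => p hp; apply: hN; by exists p.
apply: measurableU => //; case: ifP => // _; apply: measurableC.
exact: bigcupT_measurable.
Qed.

Lemma measurable_nat_sandwich d (Omega : measurableType d) (K : Omega -> nat)
    (a b : nat) : (forall m, measurable [set w | K w = m]) ->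
  measurable [set w | (a <= K w)%N /\ (K w <= b)%N].
Proof.
move=> mK; rewrite (_ : [set w | _] =
    \bigcup_(m in [set m | (a <= m <= b)%N]) [set w | K w = m]).
  exact: bigcup_measurable.
apply/seteqP; split => w /=.
  by move=> [aK Kb]; exists (K w) => //=; rewrite aK.
by move=> [m /= /andP[am mb] ->].
Qed.

(** * Comparison of the mode counts of two nearby step functions *)

Section ModeCount.
Variables (R : realType) (n : nat).
Hypothesis n_gt0 : (0 < n)%N.

(** A bound on the admissible indices keeps [xget] from falling back on its default; index [0] is
    admissible because [s_{-1} = +oo]. *)
Lemma is_max_kmode (e : R) (g : R -> R) (k : nat) :
  (forall j, (e%:E <= smode_pred n j g)%E -> (j <= k)%N) ->
  is_max_nat [set j | (e%:E <= smode_pred n j g)%E] (kmode n e g).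
Proof.
move=> ub; apply: xgetPex; pose p j := `[< (e%:E <= smode_pred n j g)%E >].
have p0 : exists j, p j by exists 0%N; apply/asboolP; rewrite /= leey.
have pk j : p j -> (j <= k)%N by move=> /asboolP; exact: ub.
have [m /asboolP pm mmax] := ex_maxnP p0 pk.
by exists m; split => // j /= pj; apply: mmax; exact/asboolP.
Qed.

Lemma smode_le_dK (j k : nat) (g h : R -> R) :
  Xmodes n k h -> (k <= j)%N -> (smode n j g <= dK g h)%E.
Proof.
move=> [hP hk] kj; apply: ereal_inf_lbound; exists h => //; split => //.
by apply: le_trans hk _; rewrite lee_fin ler_nat.
Qed.

(** Index [j.+1] refers to [s_j]. If [k <= j], then [h] competes in [s_j(g)], which falls below
    [e]. *)
Lemma kmode_ub (e : R) (g h : R -> R) (k j : nat) :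
  Xmodes n k h -> (dK g h < e%:E)%E ->
  (e%:E <= smode_pred n j g)%E -> (j <= k)%N.
Proof.
move=> hX gh; case: j => [//|j] /= ej; rewrite ltnNge; apply/negP => kj.
have := le_lt_trans (le_trans ej (smode_le_dK g hX kj)) gh.
by rewrite ltxx.
Qed.

Lemma dK_refl (g : R -> R) : PC n g -> dK g g = 0%E.
Proof.
move=> gP; rewrite (dK_PC n_gt0 gP gP); congr EFin; apply/le_anti/andP; split.
  by apply: knot_norm_le_bound => // i _; rewrite subrr normr0.
exact: knot_norm_ge0.
Qed.

Lemma dK_sym (g h : R -> R) : PC n g -> PC n h -> dK g h = dK h g.
Proof.
move=> gP hP; rewrite (dK_PC n_gt0 gP hP) (dK_PC n_gt0 hP gP) -knot_normN.
by congr EFin; apply: eq_knot_norm => i _; rewrite opprB.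
Qed.

Lemma smode_dK_lipschitz (j : nat) (g h : R -> R) :
  PC n g -> PC n h -> (smode n j g <= smode n j h + dK g h)%E.
Proof.
move=> gP hP; rewrite !(smode_knot_dist n_gt0)// (dK_PC n_gt0)//.
exact: knot_dist_lipschitz.
Qed.

Lemma kmode_sandwich (t : R) (g h : R -> R) (k : nat) :
    0 < t -> PC n g -> Xmodes n k h -> (dK g h < t%:E)%E ->
  (kmode n (2 * t) h <= kmode n t g)%N /\ (kmode n t g <= k)%N.
Proof.
move=> t0 gP hX gh; have hP : PC n h by case: hX.
have [gmax gub] := is_max_kmode (fun j => kmode_ub hX gh (j := j)).
(* [h] is its own competitor at distance zero, so its mode count is a genuine maximum. *)
have hh : (dK h h < (2 * t)%:E)%E by rewrite dK_refl// lte_fin mulr_gt0.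
have [hmax _] := is_max_kmode (fun j => kmode_ub hX hh (j := j)).
split; last exact: (kmode_ub hX gh gmax).
have [r dr] : exists r, dK h g = r%:E by rewrite (dK_PC n_gt0 hP gP); eexists.
have rt : r < t by rewrite -lte_fin -dr (dK_sym hP gP).
apply: gub => /=; move: hmax; case: (kmode n (2 * t) h) => [_|j] /=.
  exact: leey.
move=> tj; move: (le_trans tj (smode_dK_lipschitz j hP gP)); rewrite dr.
move: (smode n j g) => {gh tj dr} [s| |]; rewrite ?leey// -?EFinD ?lee_fin; lra.
Qed.

Lemma eq_knot_dist (j : nat) (c c' : nat -> R) :
  (forall i, (i < n)%N -> c i = c' i) -> knot_dist n j c = knot_dist n j c'.
Proof.
move=> cc'; congr ereal_inf; apply: eq_imagel => h _; congr EFin.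
by apply: eq_knot_norm => i lin; rewrite cc'.
Qed.

End ModeCount.

Theorem mainTheorem5 (R : realType) (d : measure_display)
    (Omega : measurableType d) (P : probability Omega R)
    (X : set (R -> R)) (XL : X `<=` @Lreg R) (f : R -> R) (fX : X f)
    (n : nat) (n_ge1 : (1 <= n)%N)
    (alpha : R) (alpha01 : 0 < alpha < 1)
    (eps : 'I_n -> {RV P >-> R})
    (eps_indep : mutually_independent P (fun i => eps i : Omega -> R))
    (eps_mean0 : forall i, ('E_P[eps i] = 0)%E)
    (kappa v : R) (kappa_gt0 : 0 < kappa) (v_gt0 : 0 < v)
    (eps_moments : forall (i : 'I_n) (m : nat), (2 <= m)%N ->
      ('E_P[fun w => (`|eps i w| ^+ m)%R]
         <= (v * m`!%:R * kappa ^+ (m - 2) / 2)%:E)%E)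
    (fn : R -> R)
    (fnE : PC_with_values (fun i : 'I_n => f (i%:R / n%:R)) fn)
    (Yn : Omega -> R -> R)
    (YnE : forall w,
      PC_with_values (fun i : 'I_n => f (i%:R / n%:R) + eps i w) (Yn w))
    (k : nat) (fn_k : Xmodes n k fn) :
  let tau_a := tau n kappa v (alpha / 2) in
  let event := [set w | (kmode n (2 * tau_a) fn <= kmode n tau_a (Yn w))%N
                        /\ (kmode n tau_a (Yn w) <= k)%N] in
  measurable event /\ ((1 - alpha)%:E <= P event)%E.
Proof.
move=> tau_a event.
(* A successor makes [inord] available for indexing the noise by [nat]. *)
case: n n_ge1 eps eps_indep eps_mean0 eps_moments fnE YnE fn_k @tau_a @event =>
  [//|n] n_ge1 eps eps_indep eps_mean0 eps_moments fnE YnE fn_k tau_a event.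
have beta01 : 0 < alpha / 2 < 1 by lra.
have t0 : 0 < tau_a by exact: tau_gt0.
have n0 : 0 < n.+1%:R :> R by rewrite ltr0n.
pose e i : Omega -> R := eps (inord i).
have me i : measurable_fun setT (e i) by [].
have YP w : PC n.+1 (Yn w) by case: (YnE w).
have fP : PC n.+1 fn by case: fnE.
have cvY (i : 'I_n.+1) w :
    cell_value n.+1 (Yn w) i = cell_value n.+1 fn i + e i w.
  rewrite (PC_with_values_cell_value n_ge1 i (YnE w)).
  by rewrite (PC_with_values_cell_value n_ge1 i fnE) /e inord_val.
pose Y i w := cell_value n.+1 fn i + e i w.
have mY i : measurable_fun setT (Y i) by exact: measurable_funD.
have ms j : measurable [set w | (tau_a%:E <= smode_pred n.+1 j (Yn w))%E].
  case: j => [|j] /=.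
    rewrite (_ : [set _ | _] = setT)//; apply/seteqP; split => // w _ /=.
    by rewrite leey.
  rewrite (_ : [set _ | _] = ~` [set w | (knot_dist n.+1 j (Y ^~ w) < tau_a%:E)%E]).
    exact/measurableC/measurable_knot_dist_lt.
  (* The distance depends on [Yn w] only through its cell values, which are measurable in [w]. *)
  have eqY w : smode n.+1 j (Yn w) = knot_dist n.+1 j (Y ^~ w).
    rewrite (smode_knot_dist n_ge1)//; apply: eq_knot_dist => i lin.
    exact: (cvY (Ordinal lin)).
  by apply/seteqP; split => w /=; rewrite eqY leNgt => /negP.
have mk m : measurable [set w | kmode n.+1 tau_a (Yn w) = m].
  exact: (measurable_xget_max (A := fun w =>
    [set j | (tau_a%:E <= smode_pred n.+1 j (Yn w))%E])).
have mevent : measurable event.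
  exact: (measurable_nat_sandwich (kmode n.+1 (2 * tau_a) fn) k mk).
split => //.
pose x := n.+1%:R * tau_a; have x0 : 0 < x by rewrite mulr_gt0.
(* One-sided passage of the partial sums above [n * tau]; it is applied to the noise and to its
   negative. *)
pose dev (u : nat -> Omega -> R) := \bigcup_(m in [set m | (m <= n.+1)%N])
  [set w | x <= \sum_(i < m) u i w].
have Pdev u : (forall i, measurable_fun setT (u i)) ->
    independent_upto P n.+1 u ->
    (forall i, (\int[P]_w (u i w)%:E = 0)%E) ->
    (forall i m, (2 <= m)%N -> (\int[P]_w (`|u i w| ^+ m)%:E <=
      (v * m`!%:R * kappa ^+ (m - 2) / 2)%:E)%E) ->
    measurable (dev u) /\ (P (dev u) <= (alpha / 4)%:E)%E.
  move=> mu iu u0 um; split.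
    apply: bigcup_measurable => m _; rewrite -[X in measurable X]setTI.
    by apply: measurable_fun_le => //; exact: measurable_sum.
  have := bernstein_maximal n_ge1 kappa_gt0 v_gt0 mu iu (fun i _ => u0 i)
    (fun i m _ => um i m) x0.
  (* The threshold is taken at [beta = alpha / 2], so each one-sided event has probability at most
     [beta / 2 = alpha / 4]. *)
  rewrite (tau_exponent n_ge1 kappa_gt0 v_gt0 beta01) opprK lnK; last first.
    by rewrite posrE; lra.
  by rewrite (_ : alpha / 2 / 2 = alpha / 4)//; field.
have ie : independent_upto P n.+1 e by exact: (independent_upto_inord eps_indep).
have e0 i : (\int[P]_w (e i w)%:E = 0)%E.
  by have := eps_mean0 (inord i); rewrite unlock.
have em i m : (2 <= m)%N -> (\int[P]_w (`|e i w| ^+ m)%:E <=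
      (v * m`!%:R * kappa ^+ (m - 2) / 2)%:E)%E.
  by move=> m2; have := eps_moments (inord i) m m2; rewrite unlock.
have [mdp Pdp] := Pdev e me ie e0 em.
pose ne i w := - e i w.
have [mdn Pdn] : measurable (dev ne) /\
    (P (dev ne) <= (alpha / 4)%:E)%E.
  apply: Pdev.
  - by move=> i; exact: measurableT_comp.
  - by apply: (independent_upto_comp _ ie); exact: oppr_measurable.
  - move=> i; rewrite (eq_integral (fun w => ((-1)%:E * (e i w)%:E)%E)); last first.
      by move=> w _; rewrite -EFinM mulN1r.
    rewrite integralZl ?e0 ?mule0//.
    apply: (@integrable_of_second_moment _ _ _ _ _ v) => //.
    apply: le_trans (em i 2%N _) _ => //.
    by rewrite subnn expr0 mulr1 lee_fin !factS fact0 !muln1 mulfK.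
  - by move=> i m m2; under eq_integral do rewrite /ne normrN; exact: em.
(* Outside both events every partial sum is strictly below [n * tau] in absolute value, which gives
   the strict inequality that [kmode_sandwich] requires. *)
have good : ~` (dev e `|` dev ne) `<=` event.
  move=> w /not_orP[np nn]; apply: (kmode_sandwich n_ge1 t0) => //.
  rewrite (dK_sym n_ge1)// (dK_PC n_ge1)// lte_fin.
  rewrite -knot_normN; apply: knot_norm_lt => // m mn.
  have -> : partial_mean n.+1 (fun i => - (cell_value n.+1 fn i -
      cell_value n.+1 (Yn w) i)) m = (\sum_(i < m) e i w) / n.+1%:R.
    congr (_ / _); apply: eq_bigr => i _.
    have lin : (i < n.+1)%N by exact: leq_trans (ltn_ord i) mn.
    by rewrite (cvY (Ordinal lin)) /=; ring.
  rewrite normrM (@ger0_norm _ n.+1%:R^-1) ?invr_ge0// ltr_pdivrMr//.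
  rewrite mulrC -/x ltr_norml; apply/andP; split.
    rewrite ltrNl ltNge; apply/negP => h; apply: nn; exists m => //=.
    by rewrite /ne sumrN.
  by rewrite ltNge; apply/negP => h; apply: np; exists m.
have mbad : measurable (dev e `|` dev ne) by exact: measurableU.
have Pbad : (P (dev e `|` dev ne) <= (alpha / 2)%:E)%E.
  apply: le_trans (measureU2 _ _ _) _ => //.
  by apply: le_trans (leeD Pdp Pdn) _; rewrite -EFinD lee_fin; lra.
apply: (@le_trans _ _ (P (~` (dev e `|` dev ne)))); last first.
  by apply: le_measure; rewrite ?inE//; exact: measurableC.
rewrite probability_setC//; apply: (@le_trans _ _ (1 - (alpha / 2)%:E)%E).
  by rewrite -EFinB lee_fin; lra.
exact: leeB.
Qed.
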